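(* Let $m_0\ge5$ be an odd integer. Let $P$ be the defining ideal of the monomial curve that corresponds to the almost arithmetic sequence $m_0,\ m_1=m_0+1,\ m_2=m_0-1$ (so $n=2$, $p=1$). Then the set of Patil generators $\Omega$ of $P$ is not a Groebner basis of $P$ with respect to the grevlex monomial order with $x_0<x_1<x_2$ and with the grading $wt(x_i)=m_i$.
   Context: The set $\Omega$ is defined in the following general setting, to be applied with $n=2$, $p=1$, $m_1=m_0+1$, $m_2=m_0-1$. Setting. Let $K$ be a field, $n\ge 2$ an integer, $p=n-1$. Let $m_0,\dots,m_p$ be an arithmetic sequence of positive integers with $0<m_0<\cdots<m_p$, let $m_n$ be an arbitrary positive integer, and assume $\gcd(m_0,\dots,m_n)=1$. Let $\mathbb N_0=\{0,1,2,\dots\}$, $\Gamma=\sum_{i=0}^n\mathbb N_0m_i$, $\Gamma'=\sum_{i=0}^p\mathbb N_0m_i$. Assume $\Gamma$ is minimally generated by $m_0,\dots,m_n$. The defining ideal $P$ is the kernel of the $K$-algebra homomorphism $\eta:K[x_0,\dots,x_n]\to K[t]$, $\eta(x_i)=t^{m_i}$. For integers $a,b$ let $[a,b]=\{t\in\mathbb Z\mid a\le t\le b\}$ (empty if $a>b$). For an integer $t\ge0$ define $q_t\in\mathbb Z$, $r_t\in[1,p]$ and $g_t$ by $t=q_tp+r_t$ and $g_t=q_tm_p+m_{r_t}$ (so $q_0=-1$, $r_0=p$, $g_0=0$). Parameters. Let $S=\{\gamma\in\Gamma\mid\gamma-m_0\notin\Gamma\}$, $u=\min\{t\ge0\mid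 g_t\notin S\}$, $\upsilon=\min\{b\ge1\mid bm_n\in\Gamma'\}$. By a known lemma of Patil and Singh there exist unique integers $w\in[0,\upsilon-1]$, $z\in[0,u-1]$, $\lambda\ge1$, $\mu\ge0$, $\nu\ge2$ such that (i) $g_u=\lambda m_0+wm_n$; (ii) $\upsilon m_n=\mu m_0+g_z$; (iii) $g_{u-z}+(\upsilon-w)m_n=\nu m_0$, where $\nu=\lambda+\mu+1$ if $r_{u-z}<r_u$ and $\nu=\lambda+\mu$ if $r_{u-z}\ge r_u$. Put $q=q_u$, $r=r_u$, $q'=q_{u-z}$, $r'=r_{u-z}$, $V=[0,u-1]\times[0,\upsilon-1]$, $W=[u-z,u-1]\times[\upsilon-w,\upsilon-1]$. Index sets. $I=[0,p-r]$ if $\mu\ne0$ or $W=\emptyset$, and $I=[\max(r_z-r+1,0),p-r]$ if $\mu=0$ and $W\ne\emptyset$. $J=\emptyset$ if $W=\emptyset$, and $J=[0,\min(z-1,p-r')]$ if $W\neq\emptyset$. Binomials. $\varphi_i=x_{r+i}x_p^{q}-x_0^{\lambda-1}x_ix_n^{w}$; $\psi_j=x_{r'+j}x_p^{q'}x_n^{\upsilon-w}-x_0^{\nu-1}x_j$; $\theta=x_n^{\upsilon}-x_0^{\mu}x_{r-r'}x_p^{q-q'}$ if $r'<r$, and $\theta=x_n^{\upsilon}-x_0^{\mu}x_{p+r-r'}x_p^{q-q'-1}$ if $r'\ge r$ (with $x_px_p^{-1}$ read as $1$); $\xi_{i,j}=x_ix_j-x_0x_{i+j}$ if $i+j\le p$,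 and $\xi_{i,j}=x_ix_j-x_{i+j-p}x_p$ if $i+j>p$. Patil generators: $\Omega=\{\xi_{i,j}\mid 1\le i\le j\le p-1\}\cup\{\theta\}\cup\{\varphi_i\mid i\in I\}\cup\{\psi_j\mid j\in J\}$ (known, due to Patil, to be a minimal generating set of $P$). Monomial order. Monomials are compared first by weighted degree $\sum a_im_i$; for equal weighted degree, $\prod_{i=0}^n x_i^{a_i}>\prod_{i=0}^n x_i^{b_i}$ if the left-most nonzero entry of $(a_0-b_0,\dots,a_n-b_n)$ is negative. *)

(* Defs.v *)
From HB Require Import structures.
From mathcomp Require Import all_boot all_order all_algebra.
From mathcomp.multinomials Require Import mpoly.
From mathcomp Require Import ring lra zify.

Set Implicit Arguments.
Unset Strict Implicit.
Unset Printing Implicit Defensive.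

Import Order.TTheory GRing.Theory.
Local Open Scope ring_scope.

(** * Initial ideals and Groebner bases for an arbitrary monomial order *)

(* [lt a b] reads: the monomial 'X_[a] is smaller than 'X_[b]. *)
Definition is_lead_monomial (K : fieldType) (k : nat) (lt : rel 'X_{1..k})
    (f : {mpoly K[k]}) (a : 'X_{1..k}) : Prop :=
  a \in msupp f /\ (forall b, b \in msupp f -> b != a -> lt b a).

Definition ideal_gen (R : comNzRingType) (A : R -> Prop) (f : R) : Prop :=
  exists2 s : seq (R * R),
    (forall cg, cg \in s -> A cg.2) & f = \sum_(cg <- s) cg.1 * cg.2.

(* The zero polynomial has no leading monomial, so it contributes nothing. *)
Definition initial_ideal (K : fieldType) (k : nat) (lt : rel 'X_{1..k})
    (A : {mpoly K[k]} -> Prop) : {mpoly K[k]} -> Prop :=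
  ideal_gen (fun h => exists f a,
    [/\ A f, is_lead_monomial lt f a & h = 'X_[a]]).

Definition is_groebner_basis (K : fieldType) (k : nat) (lt : rel 'X_{1..k})
    (I : {mpoly K[k]} -> Prop) (G : seq {mpoly K[k]}) : Prop :=
  (forall g, g \in G -> I g) /\
  (forall h, initial_ideal lt (fun g => g \in G) h <-> initial_ideal lt I h).

(** * Monomial curves *)

(* A sequence of weights m_0, ..., m_n is a function on nat, of which only the
   values at 0, ..., n matter. *)

Definition wdeg (n : nat) (m : nat -> nat) (a : 'X_{1..n.+1}) : nat :=
  (\sum_(i < n.+1) a i * m i)%N.

(* Ties in the weighted degree are broken by: a < b iff the left-most nonzero
   entry of b - a is negative. *)
Definition wgrevlex_lt (n : nat) (m : nat -> nat) : rel 'X_{1..n.+1} :=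
  fun a b =>
    (wdeg m a < wdeg m b)%N ||
    ((wdeg m a == wdeg m b) &&
     [exists i : 'I_n.+1, (b i < a i)%N &&
        [forall j : 'I_n.+1, (j < i)%N ==> (b j == a j)]]).

Definition curve_map (K : fieldType) (n : nat) (m : nat -> nat)
    (f : {mpoly K[n.+1]}) : {poly K} :=
  mmap (@polyC K) (fun i : 'I_n.+1 => 'X^(m i)) f.

Definition defining_ideal (K : fieldType) (n : nat) (m : nat -> nat)
    (f : {mpoly K[n.+1]}) : Prop :=
  curve_map m f = 0.

(* sgrp m k is the numerical semigroup generated by m_0, ..., m_k, as a subset
   of the integers: Gamma is sgrp m n and Gamma' is sgrp m p. *)
Definition sgrp (m : nat -> nat) (k : nat) (g : int) : Prop :=
  exists a : nat -> nat, g = (\sum_(i < k.+1) a i * m i)%N%:Z.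

Definition almost_arithmetic (n : nat) (m : nat -> nat) : Prop :=
  [/\ (1 < n)%N,
      forall i, (i <= n)%N -> (0 < m i)%N,
      exists2 d, (0 < d)%N & forall i, (i < n)%N -> m i = (m 0 + i * d)%N,
      (\big[gcdn/0]_(i < n.+1) m i)%N = 1%N &
      forall (i : nat) (a : nat -> nat), (i <= n)%N -> a i = 0%N ->
        (\sum_(j < n.+1) a j * m j)%N <> m i].

(** * Patil's parameters and generators *)

(* t = q_t p + r_t with r_t in [1, p]; in particular q_0 = -1 and r_0 = p. *)
Definition patil_q (p t : nat) : int := ((t%:Z - 1) %/ p%:Z)%Z.
Definition patil_r (p t : nat) : nat := absz (t%:Z - patil_q p t * p%:Z)%R.

Lemma patil_qrP (p t : nat) : (0 < p)%N ->
  t%:Z = patil_q p t * p%:Z + (patil_r p t)%:Z /\ (1 <= patil_r p t <= p)%N.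
Proof.
move=> p0; rewrite /patil_r.
have h := divz_eq (t%:Z - 1) p%:Z.
have h1 : (0 <= (t%:Z - 1) %% p%:Z)%Z by apply: modz_ge0; lia.
have h2 : ((t%:Z - 1) %% p%:Z < p%:Z)%Z by apply: ltz_pmod; lia.
rewrite -/(patil_q p t) in h; move: h h1 h2.
move: (patil_q p t) ((t%:Z - 1) %% p%:Z)%Z => q s.
move: (q * p%:Z) => qp; lia.
Qed.

Definition patil_g (p : nat) (m : nat -> nat) (t : nat) : int :=
  patil_q p t * (m p)%:Z + (m (patil_r p t))%:Z.

Definition apery (n : nat) (m : nat -> nat) (g : int) : Prop :=
  sgrp m n g /\ ~ sgrp m n (g - (m 0%N)%:Z).

Definition is_least (A : nat -> Prop) (x : nat) : Prop :=
  A x /\ (forall y, A y -> (x <= y)%N).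

Record patil_params := PatilParams {
  pu : nat; pv : nat; pw : nat; pz : nat;
  plambda : nat; pmu : nat; pnu : nat }.

(* The seven numbers are uniquely determined by these conditions
   (Patil and Singh). *)
Definition patil_paramsP (n : nat) (m : nat -> nat) (c : patil_params) : Prop :=
  let p := n.-1 in
  let: PatilParams u v w z lambda mu nu := c in
  [/\ is_least (fun t => ~ apery n m (patil_g p m t)) u,
      is_least (fun b => (1 <= b)%N /\ sgrp m p (b * m n)%N%:Z) v,
      [/\ (w < v)%N, (z < u)%N, (1 <= lambda)%N & (2 <= nu)%N] &
      [/\ patil_g p m u = (lambda * m 0 + w * m n)%N%:Z,
          (v * m n)%N%:Z = (mu * m 0)%N%:Z + patil_g p m z,
          patil_g p m (u - z) + ((v - w) * m n)%N%:Z = (nu * m 0)%N%:Z &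
          nu = if (patil_r p (u - z) < patil_r p u)%N then (lambda + mu + 1)%N
               else (lambda + mu)%N]].

(* The integer interval [a, b], for natural numbers a and b. *)
Definition seg (a b : nat) : seq nat := index_iota a b.+1.

Section Generators.

Context (K : fieldType) (n : nat).

Definition xv (i : nat) : {mpoly K[n.+1]} := 'X_(inord i).

Definition patil_xi (i j : nat) : {mpoly K[n.+1]} :=
  let p := n.-1 in
  if (i + j <= p)%N then xv i * xv j - xv 0 * xv (i + j)
  else xv i * xv j - xv (i + j - p) * xv p.

(* q = q_u and q' = q_{u-z} are nonnegative because z < u, so taking absolute
   values only converts them to nat.  In theta, r <= r' and q = q' force z = 0
   and r = r', which is the case where x_p x_p^{-1} is read as 1. *)
Definition patil_theta (c : patil_params) : {mpoly K[n.+1]} :=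
  let p := n.-1 in
  let: PatilParams u v w z lambda mu nu := c in
  let q := absz (patil_q p u) in let r := patil_r p u in
  let q' := absz (patil_q p (u - z)) in let r' := patil_r p (u - z) in
  if (r' < r)%N then
    xv n ^+ v - xv 0 ^+ mu * xv (r - r') * xv p ^+ (q - q')
  else
    xv n ^+ v - xv 0 ^+ mu *
      (if q == q' then 1 else xv (p + r - r') * xv p ^+ (q - q' - 1)).

Definition patil_phi (c : patil_params) (i : nat) : {mpoly K[n.+1]} :=
  let p := n.-1 in
  let: PatilParams u v w z lambda mu nu := c in
  let q := absz (patil_q p u) in let r := patil_r p u in
  xv (r + i) * xv p ^+ q - xv 0 ^+ (lambda - 1) * xv i * xv n ^+ w.

Definition patil_psi (c : patil_params) (j : nat) : {mpoly K[n.+1]} :=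
  let p := n.-1 in
  let: PatilParams u v w z lambda mu nu := c in
  let q' := absz (patil_q p (u - z)) in let r' := patil_r p (u - z) in
  xv (r' + j) * xv p ^+ q' * xv n ^+ (v - w) - xv 0 ^+ (nu - 1) * xv j.

(* Here u and v are positive, so that seg _ u.-1 and seg _ v.-1 are correct. *)
Definition patil_W (c : patil_params) : seq (nat * nat) :=
  let: PatilParams u v w z lambda mu nu := c in
  [seq (a, b) | a <- seg (u - z) u.-1, b <- seg (v - w) v.-1].

(* Truncated subtraction implements max(r_z - r + 1, 0). *)
Definition patil_I (c : patil_params) : seq nat :=
  let p := n.-1 in
  let: PatilParams u v w z lambda mu nu := c in
  let r := patil_r p u in
  if (mu != 0)%N || (patil_W c == [::]) then seg 0 (p - r)
  else seg ((patil_r p z + 1) - r) (p - r).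

(* If W is nonempty then z is positive. *)
Definition patil_J (c : patil_params) : seq nat :=
  let p := n.-1 in
  let: PatilParams u v w z lambda mu nu := c in
  let r' := patil_r p (u - z) in
  if patil_W c == [::] then [::] else seg 0 (minn (z - 1) (p - r')).

Definition patil_Omega (c : patil_params) : seq {mpoly K[n.+1]} :=
  let p := n.-1 in
  [seq patil_xi i j | i <- index_iota 1 p, j <- index_iota i p] ++
  patil_theta c ::
  [seq patil_phi c i | i <- patil_I c] ++
  [seq patil_psi c j | j <- patil_J c].

End Generators.

(** * The sequence m_0, m_0 + 1, m_0 - 1 *)

Definition curve_weights (m0 : nat) : nat -> nat :=
  nth 0%N [:: m0; m0.+1; m0.-1].

(* The standing assumptions hold for these sequences, and Patil's parameters
   exist: see curve_almost_arithmetic and curve_params_exist below. *)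

Lemma patil_g_curve (m0 t : nat) :
  patil_g 1 (curve_weights m0) t = (t * m0.+1)%N%:Z.
Proof.
have [h1 h2] := @patil_qrP 1 t isT.
have hr : patil_r 1 t = 1%N by lia.
rewrite /patil_g hr /curve_weights /=; rewrite hr in h1.
have -> : patil_q 1 t = t%:Z - 1 by lia.
nia.
Qed.

Lemma sgrp_curve2 (m0 : nat) (g : int) :
  sgrp (curve_weights m0) 2 g <->
  exists a b c : nat, g = (a * m0 + b * m0.+1 + c * m0.-1)%N%:Z.
Proof.
split=> [[a ->]|[a [b [c ->]]]].
  by exists (a 0%N), (a 1%N), (a 2%N); rewrite !big_ord_recr big_ord0.
exists (nth 0%N [:: a; b; c]).
by rewrite !big_ord_recr big_ord0.
Qed.

Lemma sgrp_curve1 (m0 : nat) (g : int) :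
  sgrp (curve_weights m0) 1 g <->
  exists a b : nat, g = (a * m0 + b * m0.+1)%N%:Z.
Proof.
split=> [[a ->]|[a [b ->]]].
  by exists (a 0%N), (a 1%N); rewrite !big_ord_recr big_ord0.
exists (nth 0%N [:: a; b]).
by rewrite !big_ord_recr big_ord0.
Qed.

Lemma curve_almost_arithmetic (m0 : nat) : (5 <= m0)%N ->
  almost_arithmetic 2 (curve_weights m0).
Proof.
move=> h; split=> //.
- by case=> [|[|[|i]]] //= _; rewrite /curve_weights /=; lia.
- by exists 1%N => //; case=> [|[|i]] //= _; rewrite /curve_weights /=; lia.
- rewrite !big_ord_recr big_ord0 /= /curve_weights /= gcd0n.
  have -> : gcdn m0 m0.+1 = 1%N by apply/eqP; exact: coprimenS.
  by rewrite gcd1n.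
- move=> i a; rewrite !big_ord_recr big_ord0 /= /curve_weights /=.
  case: m0 h => // k h /=.
  case: i => [|[|[|i]]] //= _ ha; rewrite ha ?mul0n ?add0n ?addn0;
    move: (a 0%N) (a 1%N) (a 2%N) => x y z.
  + case: y => [|[|y]]; case: z => [|[|z]]; nia.
  + case: x => [|[|x]]; case: z => [|[|z]]; nia.
  + case: x => [|x]; case: y => [|y]; nia.
Qed.

Lemma curve_params_exist (k : nat) : (2 <= k)%N ->
  patil_paramsP 2 (curve_weights k.*2.+1)
    (PatilParams k.+1 k.+1 k k 2 0 2).
Proof.
move=> hk; split=> //=.
- split.
  + move=> [_]; apply; rewrite patil_g_curve; apply/sgrp_curve2.
    by exists 1%N, 0%N, k; rewrite /curve_weights /=; nia.
  + move=> t ht; rewrite leqNgt; apply/negP => tk; apply: ht.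
    rewrite /apery patil_g_curve; split.
      by apply/sgrp_curve2; exists 0%N, t, 0%N; rewrite /curve_weights; nia.
    case/sgrp_curve2 => a [b [c]]; rewrite /curve_weights /= => e.
    have e' : (t * (k.*2.+2) = a.+1 * k.*2.+1 + b * k.*2.+2 + c * k.*2)%N by nia.
    have e2 : (2 * (t * k) + 2 * t = 2 * ((a.+1 + b + c) * k) + a.+1 + 2 * b)%N by nia.
    case: (ltnP t (a.+1 + b + c)%N) => hs.
      by have := leq_mul hs (leqnn k); rewrite mulSn; lia.
    by have := leq_mul hs (leqnn k); lia.
- split.
  + split=> //; apply/sgrp_curve1; exists 0%N, k; rewrite /curve_weights /=; nia.
  + move=> b [b1 /sgrp_curve1[x [y]]]; rewrite /curve_weights /= => e.
    rewrite leqNgt; apply/negP => tk.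
    have e2 : (2 * (b * k) = 2 * ((x + y) * k) + x + 2 * y)%N by nia.
    case: (ltnP (x + y)%N b) => hs; last by have := leq_mul hs (leqnn k); nia.
    by have := leq_mul hs (leqnn k); rewrite mulSn; nia.
- have r1 t : patil_r 1 t = 1%N by have := @patil_qrP 1 t isT; lia.
  rewrite !patil_g_curve !r1 /curve_weights /=; split; nia.
Qed.

(* Main.v *)
Require Import Defs.
From mathcomp Require Import all_boot all_order all_algebra.
From mathcomp.multinomials Require Import mpoly.
From mathcomp Require Import zify.
Import GRing.Theory.

(** Write m0 = 2k + 1, so that the weights of x_0, x_1, x_2 are 2k + 1, 2k + 2
    and 2k.  Patil's parameters are then forced (curve_params_unique):
    u = v = k + 1, w = z = k, lambda = 2, mu = 0, nu = 2.  As mu = 0 and W is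
    nonempty, the index set I is empty, so no phi_i survives, and P is a
    complete intersection with generators (patil_Omega_curve)
      theta = x_2^(k+1) - x_1^k   and   psi_0 = x_1 x_2 - x_0^2.
    Since x_1 < x_2 and x_0 is smallest, their leading monomials are x_2^(k+1)
    and x_1 x_2.  The S-polynomial of the two is, up to sign,
      x_1^(k+1) - x_0^2 x_2^k,
    which lies in P because both terms have weight 2 (k+1)^2.  Its leading
    monomial x_1^(k+1) is a power of x_1, which neither of the two leading
    monomials divides; by groebner_lead_dvd this is impossible for a Groebner
    basis. *)

Section GroebnerCriterion.

Local Open Scope ring_scope.

Context (K : fieldType) (k : nat) (lt : rel 'X_{1..k}).

Lemma mcoeff_mulX_neq0 (f : {mpoly K[k]}) (a b : 'X_{1..k}) :
  (f * 'X_[b])@_a != 0 -> (b <= a)%MM.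
Proof.
rewrite -mcoeff_msupp (perm_mem (msuppMX _ _)) => /mapP[d _ ->].
exact: lem_addr.
Qed.

(** A monomial occurring in a combination of monomials occurs in one of the
    summands, hence is a multiple of one of these monomials. *)
Lemma initial_idealX (A : {mpoly K[k]} -> Prop) (a : 'X_{1..k}) :
  initial_ideal lt A 'X_[a] ->
  exists f b, [/\ A f, is_lead_monomial lt f b & (b <= a)%MM].
Proof.
case=> s hs eqX.
have /hasP[cg cgs nz] : has (fun cg => (cg.1 * cg.2)@_a != 0) s.
  apply: contraT; rewrite -all_predC => /allP h0.
  have : ('X_[a] : {mpoly K[k]})@_a = 0.
    rewrite eqX raddf_sum big_seq big1 // => cg /h0 /=.
    by rewrite negbK => /eqP.
  by rewrite mcoeffX eqxx => /eqP; rewrite oner_eq0.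
have [f [b [Af lb Eg]]] := hs cg cgs.
by exists f, b; split=> //; apply: (@mcoeff_mulX_neq0 cg.1); rewrite -Eg.
Qed.

Lemma groebner_lead_dvd (I : {mpoly K[k]} -> Prop) (G : seq {mpoly K[k]})
    (f : {mpoly K[k]}) (a : 'X_{1..k}) :
  is_groebner_basis lt I G -> I f -> is_lead_monomial lt f a ->
  exists g b, [/\ g \in G, is_lead_monomial lt g b & (b <= a)%MM].
Proof.
move=> [_ eqin] If lfa; apply: initial_idealX; apply/eqin.
exists [:: (1, 'X_[a])]; last by rewrite big_seq1 mul1r.
by move=> cg /[!inE]/eqP->; exists f, a.
Qed.

Lemma msupp_binomial (a b : 'X_{1..k}) : a != b ->
  msupp ('X_[a] - 'X_[b] : {mpoly K[k]}) =i [:: a; b].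
Proof.
move=> ab d; rewrite mcoeff_msupp mcoeffB !mcoeffX !inE !(eq_sym d).
have [<-|_] := eqVneq a d; first by rewrite (eq_sym b) (negPf ab) subr0 oner_eq0.
by case: (b == d); rewrite ?subrr ?eqxx // sub0r oppr_eq0 oner_eq0.
Qed.

(** For a binomial only the two exponents have to be compared, so [lt] may be
    an arbitrary relation. *)
Lemma lead_binomial (a b : 'X_{1..k}) : a != b -> lt b a ->
  is_lead_monomial lt ('X_[a] - 'X_[b] : {mpoly K[k]}) a.
Proof.
move=> ab ba; split=> [|d]; rewrite msupp_binomial // !inE ?eqxx //.
by case/orP=> /eqP-> //; rewrite eqxx.
Qed.

End GroebnerCriterion.

Section MonomialCurves.

Local Open Scope ring_scope.

Context (K : fieldType) (n : nat) (m : nat -> nat).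

Lemma curve_mapX (a : 'X_{1..n.+1}) :
  curve_map m ('X_[a] : {mpoly K[n.+1]}) = 'X^(wdeg m a).
Proof.
rewrite /curve_map mmapX /mmap1 /wdeg -prodrXr.
by apply: eq_bigr => i _; rewrite -exprM mulnC.
Qed.

Lemma binomial_in_ideal (a b : 'X_{1..n.+1}) : wdeg m a = wdeg m b ->
  defining_ideal m ('X_[a] - 'X_[b] : {mpoly K[n.+1]}).
Proof.
move=> eqw; rewrite /defining_ideal.
rewrite [curve_map _ _]mmapB -!/(curve_map m _).
by rewrite !curve_mapX eqw subrr.
Qed.

End MonomialCurves.

Section ThreeVariables.

Local Open Scope ring_scope.

Definition mon3 (a b c : nat) : 'X_{1..3} :=
  (U_(inord 0) *+ a + U_(inord 1) *+ b + U_(inord 2) *+ c)%MM.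

Lemma mon3E (a b c : nat) (i : 'I_3) : mon3 a b c i = nth 0%N [:: a; b; c] i.
Proof.
rewrite /mon3 !mnmDE !mulmnE !mnm1E -!val_eqE /= !inordK //.
by case: i => [[|[|[|]]]] //= _; rewrite ?mul0n ?mul1n ?addn0 ?add0n.
Qed.

Lemma mon3_le (a b c a' b' c' : nat) :
  (mon3 a b c <= mon3 a' b' c')%MM = [&& a <= a', b <= b' & c <= c']%N.
Proof.
apply/mnm_lepP/and3P => [h|[ha hb hc] i].
  by split; [move: (h (inord 0)) | move: (h (inord 1)) | move: (h (inord 2))];
    rewrite !mon3E !inordK.
by rewrite !mon3E; case: i => [[|[|[|]]]].
Qed.

Lemma mon3_eq (a b c a' b' c' : nat) :
  (mon3 a b c == mon3 a' b' c') = [&& a == a', b == b' & c == c'].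
Proof.
apply/eqP/and3P => [h|[/eqP-> /eqP-> /eqP->]] //.
by split; apply/eqP; [move/mnmP/(_ (inord 0)): h | move/mnmP/(_ (inord 1)): h
  | move/mnmP/(_ (inord 2)): h]; rewrite !mon3E !inordK.
Qed.

Lemma mon3X (K : fieldType) (a b c : nat) :
  'X_[mon3 a b c] = xv K 2 0 ^+ a * xv K 2 1 ^+ b * xv K 2 2 ^+ c.
Proof. by rewrite /xv !mpolyXn -!mpolyXD. Qed.

Lemma wdeg_mon3 (m : nat -> nat) (a b c : nat) :
  @wdeg 2 m (mon3 a b c) = (a * m 0 + b * m 1 + c * m 2)%N.
Proof. by rewrite /wdeg !big_ord_recr big_ord0 /= !mon3E. Qed.

(** Between monomials of equal weight the smaller one has the larger exponent
    at the first index where they differ. *)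
Lemma wgrevlex_mon3 (m : nat -> nat) (a b c a' b' c' : nat) :
  wdeg m (mon3 a b c) = wdeg m (mon3 a' b' c') ->
  wgrevlex_lt m (mon3 a b c) (mon3 a' b' c') =
  [|| a' < a, (a' == a) && (b' < b) | [&& a' == a, b' == b & c' < c]]%N.
Proof.
rewrite /wgrevlex_lt /= => ->; rewrite ltnn eqxx /=.
apply/existsP/or3P => [[i /andP[lti /forallP eqi]]|].
  have eqj j : (j < 3)%N -> (j < i)%N ->
      nth 0%N [:: a'; b'; c'] j == nth 0%N [:: a; b; c] j.
    move=> j3 ji; move: (eqi (Ordinal j3)) => /implyP/(_ ji).
    by rewrite !mon3E.
  move: lti eqj; rewrite !mon3E; case: i {eqi} => [[|[|[|]]]] //= _ lti eqj.
  - exact: Or31.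
  - by apply: Or32; rewrite lti (eqj 0).
  - by apply: Or33; rewrite lti (eqj 0) // (eqj 1).
case=> [lta|/andP[ea ltb]|/and3P[ea eb ltc]].
- exists (inord 0); rewrite !mon3E !inordK //= lta /=.
  by apply/forallP => j.
- exists (inord 1); rewrite !mon3E !inordK //= ltb /=.
  by apply/forallP => j; rewrite !mon3E; case: j => [[|[|[|]]]].
- exists (inord 2); rewrite !mon3E !inordK //= ltc /=.
  by apply/forallP => j; rewrite !mon3E; case: j => [[|[|[|]]]].
Qed.

End ThreeVariables.

Lemma is_least_unique (A : nat -> Prop) (x y : nat) :
  is_least A x -> is_least A y -> x = y.
Proof. by move=> [Ax lx] [Ay ly]; apply/eqP; rewrite eqn_leq lx // ly. Qed.

Lemma small_multiple_eq0 (N a b e : nat) :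
  e < N -> a * N = b * N + e -> e = 0.
Proof.
move=> eN h; have := modnMl a N.
by rewrite h modnMDl modn_small.
Qed.

(** The numbers u and v are defined as least elements, so comparing with the
    known parameters gives both of them.  The relation that defines w then
    reads, modulo m0 = 2k + 1, as k - w = 0, and the one that defines z as
    k - z = 0; both differences are less than m0, hence zero. *)
Lemma curve_params_unique (k : nat) (c : patil_params) : 1 < k ->
  patil_paramsP 2 (curve_weights k.*2.+1) c ->
  c = PatilParams k.+1 k.+1 k k 2 0 2.
Proof.
move=> k1; case: c => u v w z la mu nu [hu hv].
have [hu' hv' _ _] := curve_params_exist k1.
have r1 t : patil_r 1 t = 1 by have := @patil_qrP 1 t isT; lia.
have eu := is_least_unique _ _ _ hu hu'; have ev := is_least_unique _ _ _ hv hv'.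
subst u v; rewrite !patil_g_curve !r1 /curve_weights /=.
move=> [wk zk la1 nu2] [[e1] e2 e3 enu].
(* Here g_u = lambda m0 + w m_2 becomes (k-w+2) m0 = lambda m0 + (k-w). *)
have ew : w = k.
  have wk2 : w * k <= k * k by rewrite leq_mul.
  have := @small_multiple_eq0 k.*2.+1 (k - w + 2) la (k - w).
  by rewrite mulnDl mulnBl; lia.
(* Here v m_2 = mu m0 + g_z becomes mu m0 = (k-z) m0 + (k-z). *)
have ez : z = k.
  have zk2 : z * k <= k * k by rewrite leq_mul.
  have := @small_multiple_eq0 k.*2.+1 mu (k - z) (k - z).
  by rewrite mulnBl; lia.
subst w z.
have mu0 : mu = 0.
  by apply/eqP; rewrite -(eqn_pmul2r (ltn0Sn k.*2)); lia.
subst mu.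
have la2 : la = 2.
  by apply/eqP; rewrite -(eqn_pmul2r (ltn0Sn k.*2)); lia.
by subst la; congr PatilParams; lia.
Qed.

Lemma patil_Omega_curve (K : fieldType) (k : nat) : 0 < k ->
  patil_Omega K 2 (PatilParams k.+1 k.+1 k k 2 0 2) =
  [:: ('X_[mon3 0 0 k.+1] - 'X_[mon3 0 k 0])%R;
      ('X_[mon3 0 1 1] - 'X_[mon3 2 0 0])%R].
Proof.
move=> k0; have r1 t : patil_r 1 t = 1 by have := @patil_qrP 1 t isT; lia.
have q1 t : `|patil_q 1 t.+1|%N = t.
  by have := @patil_qrP 1 t.+1 isT; rewrite r1; lia.
have W0 : patil_W (PatilParams k.+1 k.+1 k k 2 0 2) == [::] = false.
  by rewrite -size_eq0 /= size_allpairs !size_iota; nia.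
rewrite /patil_Omega /patil_I /patil_J W0 /patil_theta /patil_psi /patil_phi.
rewrite -![2.-1]/1 !r1 !q1 subSnn !q1 ltnn subn0 minn0 (gtn_eqF k0) /=.
rewrite !mon3X !expr0 !expr1 !mulr1 !mul1r.
by rewrite -[1 + 1 - 1]/1 -[1 + 0]/1 -!expr2 -exprS subn1 prednK.
Qed.

Theorem mainTheorem3 (K : fieldType) (m0 : nat) (hm0 : 5 <= m0)
    (hodd : odd m0) (c : patil_params)
    (hc : patil_paramsP 2 (curve_weights m0) c) :
  ~ is_groebner_basis (@wgrevlex_lt 2 (curve_weights m0))
      (@defining_ideal K 2 (curve_weights m0)) (patil_Omega K 2 c).
Proof.
have [k Em] : exists k, m0 = k.*2.+1 by exists m0./2; lia.
subst m0; have k1 : 1 < k by lia.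
have -> := curve_params_unique _ _ k1 hc.
rewrite patil_Omega_curve; last by lia.
set m := curve_weights _ => gb.
have wE a b d : @wdeg 2 m (mon3 a b d) =
    a * k.*2.+1 + b * k.*2.+2 + d * k.*2.
  by rewrite wdeg_mon3.
(* The S-polynomial of theta and psi_0. *)
have eqf : wdeg m (mon3 0 k.+1 0) = wdeg m (mon3 2 0 k).
  by rewrite !wE; nia.
have [] := groebner_lead_dvd _ _ _ _ _ _ (mon3 0 k.+1 0) gb
  (binomial_in_ideal K _ m _ _ eqf).
  by apply: lead_binomial; rewrite ?mon3_eq // wgrevlex_mon3.
move=> g [b [gO [bsupp bmax] ble]].
have : b = mon3 0 k 0 /\ g = ('X_[mon3 0 0 k.+1] - 'X_[mon3 0 k 0])%R.
  move: gO bsupp ble; rewrite !in_cons in_nil orbF => /orP[]/eqP->;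
    rewrite msupp_binomial ?mon3_eq ?andbF // !in_cons in_nil orbF => /orP[]/eqP->;
    by rewrite mon3_le ?andbF.
move=> [Eb Eg]; subst b g.
(* x_1^k occurs in theta and divides x_1^(k+1), but it is not leading:
   x_2^(k+1) has the same weight and is larger, as its x_1-exponent is 0. *)
have := bmax (mon3 0 0 k.+1).
rewrite msupp_binomial ?mon3_eq ?in_cons ?eqxx ?andbF // => /(_ isT isT).
by rewrite wgrevlex_mon3 ?wE; lia.
Qed.
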